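(* Let $0<\delta<2$, $0\le\gamma<1$ and $t_1\ge0$ satisfy $$\gamma<\frac{-1+\sqrt{4t_1+4t_1^2+1}}{2(1+t_1)}\qquad\text{and}\qquad \frac{\gamma\mu_2}{\mu_1}<\frac{2}{1+t_1}-\delta+\gamma\le\frac{1+\gamma}{\delta\mu_1(1+t_1)} .$$ Then there exist constants $\alpha\ge0$ and $0<\rho<1$ such that, for the sequence of random iterates $\{x_k\}$ generated by the MSKM algorithm (defined in the context) with parameters $\delta,\gamma$ from any starting point $x_0\in\mathbb{R}^n$, the sequence $\{x_k\}$ converges almost surely and: 1. for all $k\ge0$, $$\mathbb{E}[d(x_{k+1},P)^2]\le\rho^k(1+\alpha)\,d(x_0,P)^2\quad\text{and}\quad \mathbb{E}[f(x_{k+1})]\le\frac{\mu_2(1+\alpha)}{2}\,\rho^k\,d(x_0,P)^2;$$ 2. the average iterate $\tilde{x}_k=\frac1k\sum_{l=1}^{k}x_l$ satisfies, for all $k\ge1$, $$\mathbb{E}[d(\tilde{x}_k,P)^2]\le\frac{(1+\alpha)\,d(x_0,P)^2}{k(1-\rho)}\quad\text{and}\quad \mathbb{E}[f(\tilde{x}_k)]\le\frac{\mu_2(1+\alpha)}{2k(1-\rho)}\,d(x_0,P)^2 .$$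
   Context: Setting: $A\in\mathbb{R}^{m\times n}$ has rows $a_1^T,\dots,a_m^T$ with $\|a_i\|=1$ for all $i$, $b\in\mathbb{R}^m$, and $P=\{x\in\mathbb{R}^n: Ax\le b\}$ is nonempty. $\|\cdot\|$ is the Euclidean norm, $d(x,P)=\inf_{z\in P}\|x-z\|$, $u^+=\max\{u,0\}$ (componentwise for vectors). Fix a sample size $\beta\in\{1,\dots,m\}$. MSKM algorithm (Momentum Sampling Kaczmarz Motzkin): given $x_0\in\mathbb{R}^n$ (deterministic), set $x_1=x_0$; for $k\ge1$, choose a subset $\tau_k\subseteq\{1,\dots,m\}$ of size $\beta$ uniformly at random (independently of the past), let $i^*\in\arg\max_{i\in\tau_k}(a_i^Tx_k-b_i)^+$ (ties broken by any rule), and set $$x_{k+1}=x_k-\delta\,(a_{i^*}^Tx_k-b_{i^*})^+a_{i^*}+\gamma(x_k-x_{k-1}).$$ The function $f:\mathbb{R}^n\to\mathbb{R}$ is $f(x)=\frac12\,\mathbb{E}_\tau\big[\big(\max_{i\in\tau}(a_i^Tx-b_i)^+\big)^2\big]$, where $\tau$ is a uniformly random $\beta$-element subset of $\{1,\dots,m\}$. Constants: $L>0$ is a Hoffman constant, i.e. $d(x,P)^2\le L^2\|(Ax-b)^+\|^2$ for all $x\in\mathbb{R}^n$; $\mu_1=\frac{1}{mL^2}$; $\mu_2=\min\{1,\frac{\beta}{m}\lambda_{\max}(A^TA)\}$. One has $0<\mu_1\le\mu_2\le1$. *)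

(* Defs.v *)
From HB Require Import structures.
From mathcomp Require Import all_boot all_order all_algebra.
From mathcomp Require Import all_classical all_reals all_analysis.

Set Implicit Arguments.
Unset Strict Implicit.
Unset Printing Implicit Defensive.

Import Order.TTheory GRing.Theory Num.Theory.
Import numFieldNormedType.Exports.

Local Open Scope classical_set_scope.
Local Open Scope ring_scope.

(* The norm that MathComp-Analysis puts on matrices is the sup norm, so the
   Euclidean norm is defined here. *)
Definition enorm (R : realType) (n : nat) (u : 'cV[R]_n) : R :=
  Num.sqrt (\sum_(i < n) u i 0 ^+ 2).

Definition dist (R : realType) (n : nat) (x : 'cV[R]_n) (C : set 'cV[R]_n) : R :=
  inf [set enorm (x - z) | z in C].

Definition pospart (R : realType) (m : nat) (u : 'cV[R]_m) : 'cV[R]_m :=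
  \col_i Num.max (u i 0) 0.

Definition arow (R : realType) (m n : nat) (A : 'M[R]_(m, n)) (i : 'I_m) :
  'cV[R]_n := (row i A)^T.

Definition polyhedron (R : realType) (m n : nat) (A : 'M[R]_(m, n))
    (b : 'cV[R]_m) : set 'cV[R]_n :=
  [set x | forall i, (A *m x) i 0 <= b i 0].

Definition resid (R : realType) (m n : nat) (A : 'M[R]_(m, n)) (b : 'cV[R]_m)
    (x : 'cV[R]_n) (i : 'I_m) : R :=
  pospart (A *m x - b) i 0.

(* Residuals are nonnegative, so starting the maximum at 0 is harmless for
   nonempty [S].  The mean over a uniform beta-subset is a finite average. *)
Definition fobj (R : realType) (m n : nat) (A : 'M[R]_(m, n)) (b : 'cV[R]_m)
    (beta : nat) (x : 'cV[R]_n) : R :=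
  2^-1 * (('C(m, beta)%:R)^-1 *
    \sum_(S : {set 'I_m} | #|S| == beta)
      (\big[Num.max/0]_(i in S) resid A b x i) ^+ 2).

(* Meant for symmetric [M] of positive size, whose real spectrum is finite and
   nonempty, so that the supremum is a maximum. *)
Definition lambda_max (R : realType) (n : nat) (M : 'M[R]_n) : R :=
  sup [set a : R | eigenvalue M a].

Definition mu1 (R : realType) (m : nat) (L : R) : R := 1 / (m%:R * L ^+ 2).

Definition mu2 (R : realType) (m n : nat) (A : 'M[R]_(m, n)) (beta : nat) : R :=
  Num.min 1 (beta%:R / m%:R * lambda_max (A^T *m A)).

(* The event that the samples and selected indices of the steps 1, ..., k - 1
   are those prescribed by [S] and [j].  These events are the atoms of the
   sigma-algebra of the past of step [k]. *)
Definition past (m : nat) (T : Type) (tau : nat -> T -> {set 'I_m})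
    (istar : nat -> T -> 'I_m) (k : nat) (S : nat -> {set 'I_m})
    (j : nat -> 'I_m) : set T :=
  [set w | forall l, (1 <= l < k)%N -> tau l w = S l /\ istar l w = j l].

(* [tau k], [istar k] are the sample and the selected index of step [k >= 1];
   their values at [k = 0] are irrelevant.  [istar] is an arbitrary measurable
   selection of maximizers, so the tie-breaking rule may depend on the past, on
   the current sample and on extra randomness; [mskm_indep] only prevents it
   from anticipating later samples. *)
Record is_MSKM (R : realType) (m n : nat) (A : 'M[R]_(m, n)) (b : 'cV[R]_m)
    (beta : nat) (delta gamma : R) (x0 : 'cV[R]_n)
    (d : measure_display) (T : measurableType d) (P : probability T R)
    (tau : nat -> T -> {set 'I_m}) (istar : nat -> T -> 'I_m)
    (x : nat -> T -> 'cV[R]_n) : Prop := {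
  mskm_tau_meas : forall k (S : {set 'I_m}), (1 <= k)%N ->
    measurable (tau k @^-1` [set S]);
  mskm_istar_meas : forall k (i : 'I_m), (1 <= k)%N ->
    measurable (istar k @^-1` [set i]);
  mskm_tau_card : forall k w, (1 <= k)%N -> #|tau k w| = beta;
  mskm_tau_unif : forall k (S : {set 'I_m}), (1 <= k)%N -> #|S| = beta ->
    P (tau k @^-1` [set S]) = (('C(m, beta)%:R)^-1)%:E;
  mskm_indep : forall k (S : {set 'I_m}) (Sp : nat -> {set 'I_m})
      (jp : nat -> 'I_m), (1 <= k)%N ->
    P ((tau k @^-1` [set S]) `&` past tau istar k Sp jp)
      = (P (tau k @^-1` [set S]) * P (past tau istar k Sp jp))%E;
  mskm_argmax : forall k w, (1 <= k)%N ->
    istar k w \in tau k w /\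
    forall i, i \in tau k w ->
      resid A b (x k w) i <= resid A b (x k w) (istar k w);
  mskm_x0 : forall w, x 0%N w = x0;
  mskm_x1 : forall w, x 1%N w = x0;
  mskm_step : forall k w, (1 <= k)%N ->
    x k.+1 w = x k w
      - (delta * resid A b (x k w) (istar k w)) *: arow A (istar k w)
      + gamma *: (x k w - x k.-1 w)
}.

Definition avg (R : realType) (n : nat) (T : Type) (x : nat -> T -> 'cV[R]_n)
    (k : nat) (w : T) : 'cV[R]_n :=
  k%:R^-1 *: \sum_(1 <= l < k.+1) x l w.

(* Main.v *)
Require Import Defs.
From HB Require Import structures.
From mathcomp Require Import all_boot all_order all_algebra.
From mathcomp Require Import all_classical all_reals all_analysis.
From mathcomp Require Import measurable_realfun.
From mathcomp Require Import ring lra.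

Set Implicit Arguments.
Unset Strict Implicit.
Unset Printing Implicit Defensive.

Import Order.TTheory GRing.Theory Num.Theory.
Import numFieldNormedType.Exports.

Local Open Scope classical_set_scope.
Local Open Scope ring_scope.

(* For z in P, expanding ||x_{k+1} - z||^2 + t1 ||x_{k+1} - x_k||^2 and using
   the convexity of u |-> (u^+)^2 bounds it by a combination of ||x_k - z||^2,
   - ||x_{k-1} - z||^2, ||x_k - x_{k-1}||^2 and the squared largest sampled
   residuals at x_k and x_{k-1}.  Taking the infimum over z, and then the
   expectation, in which the squared residuals become 2 f since tau_k is
   independent of the past, and using mu1 d(., P)^2 <= 2 f <= mu2 d(., P)^2,
   gives a two-term linear recursion for E[d(x_k, P)^2] in which the terms
   E||x_k - x_{k-1}||^2 contract, because the bound on gamma says exactly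
   gamma + (1 + t1) gamma^2 < t1.  Hence both quantities decay geometrically,
   the steps are almost surely summable, and the averages are handled by
   convexity of d(., P)^2.  The iterates take finitely many values at each
   step, so expectations are finite sums over histories. *)

(** * The Euclidean inner product *)

Definition dot (R : realType) (n : nat) (u v : 'cV[R]_n) : R :=
  \sum_(i < n) u i 0 * v i 0.

Lemma dotC (R : realType) n (u v : 'cV[R]_n) : dot u v = dot v u.
Proof. by apply: eq_bigr => i _; rewrite mulrC. Qed.

Lemma dotDl (R : realType) n (u v w : 'cV[R]_n) :
  dot (u + v) w = dot u w + dot v w.
Proof. by rewrite -big_split; apply: eq_bigr => i _; rewrite mxE mulrDl. Qed.

Lemma dotZl (R : realType) n (c : R) (u w : 'cV[R]_n) :
  dot (c *: u) w = c * dot u w.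
Proof. by rewrite mulr_sumr; apply: eq_bigr => i _; rewrite mxE mulrA. Qed.

Lemma dotNl (R : realType) n (u w : 'cV[R]_n) : dot (- u) w = - dot u w.
Proof. by rewrite -scaleN1r dotZl mulN1r. Qed.

Lemma dotBl (R : realType) n (u v w : 'cV[R]_n) :
  dot (u - v) w = dot u w - dot v w.
Proof. by rewrite dotDl dotNl. Qed.

Lemma dotDr (R : realType) n (u v w : 'cV[R]_n) :
  dot u (v + w) = dot u v + dot u w.
Proof. by rewrite dotC dotDl !(dotC u). Qed.

Lemma dotZr (R : realType) n (c : R) (u w : 'cV[R]_n) :
  dot u (c *: w) = c * dot u w.
Proof. by rewrite dotC dotZl dotC. Qed.

Lemma dotNr (R : realType) n (u w : 'cV[R]_n) : dot u (- w) = - dot u w.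
Proof. by rewrite dotC dotNl dotC. Qed.

Lemma dotBr (R : realType) n (u v w : 'cV[R]_n) :
  dot u (v - w) = dot u v - dot u w.
Proof. by rewrite dotC dotBl !(dotC u). Qed.

Lemma dot_ge0 (R : realType) n (u : 'cV[R]_n) : 0 <= dot u u.
Proof. by apply: sumr_ge0 => i _; rewrite -expr2 sqr_ge0. Qed.

Lemma enorm_ge0 (R : realType) n (u : 'cV[R]_n) : 0 <= enorm u.
Proof. exact: sqrtr_ge0. Qed.

Lemma enorm_sqr (R : realType) n (u : 'cV[R]_n) : enorm u ^+ 2 = dot u u.
Proof.
rewrite /enorm sqr_sqrtr; last by apply: sumr_ge0 => i _; rewrite sqr_ge0.
by apply: eq_bigr => i _; rewrite expr2.
Qed.

Lemma ler_enorm_coord (R : realType) n (u : 'cV[R]_n) i : `|u i 0| <= enorm u.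
Proof.
rewrite -(@ler_pXn2r _ 2) ?nnegrE ?enorm_ge0// enorm_sqr -normrX ger0_norm ?sqr_ge0//.
rewrite /dot (bigD1 i)//= -expr2 lerDl.
by apply: sumr_ge0 => j _; rewrite -expr2 sqr_ge0.
Qed.

(** Expand the nonnegative squared norm of [u - dot a u *: a], the part of [u] orthogonal to [a]. *)
Lemma CauchySchwarz_unit (R : realType) n (a u : 'cV[R]_n) :
  enorm a = 1 -> dot a u ^+ 2 <= dot u u.
Proof.
move=> a1; have aa : dot a a = 1 by rewrite -enorm_sqr a1 expr1n.
have := dot_ge0 (u - dot a u *: a).
rewrite !(dotBl, dotBr, dotZl, dotZr) aa (dotC u a); set s := dot a u; nra.
Qed.

Lemma arow_dot (R : realType) m n (A : 'M[R]_(m, n)) (x : 'cV[R]_n) i :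
  (A *m x) i 0 = dot (arow A i) x.
Proof. by rewrite mxE; apply: eq_bigr => j _; rewrite !mxE. Qed.

(** * Squared distance to a set *)

Lemma dist_ge0 (R : realType) n (x : 'cV[R]_n) (C : set 'cV[R]_n) : 0 <= dist x C.
Proof.
have [->|/set0P C0] := eqVneq C set0; first by rewrite /dist image_set0 inf0.
apply: lb_le_inf; first by case: C0 => z Cz; exists (enorm (x - z)), z.
by move=> _ [z _ <-]; exact: enorm_ge0.
Qed.

Lemma dist_le (R : realType) n (x z : 'cV[R]_n) (C : set 'cV[R]_n) :
  C z -> dist x C <= enorm (x - z).
Proof.
move=> Cz; apply: ge_inf; last by exists z.
by exists 0 => _ [y _ <-]; exact: enorm_ge0.
Qed.

Lemma dist_sqr_le (R : realType) n (x z : 'cV[R]_n) (C : set 'cV[R]_n) :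
  C z -> dist x C ^+ 2 <= dot (x - z) (x - z).
Proof.
by move=> Cz; rewrite -enorm_sqr ler_pXn2r ?nnegrE ?dist_ge0 ?enorm_ge0// dist_le.
Qed.

(** Since [dist] is an infimum of norms, not of their squares, the bound is compared through the
    square root of [c^-1 * X]. Estimates that hold for each point of the polyhedron pass to the
    distance in this way, without a nearest point. *)
Lemma dist_sqr_glb (R : realType) n (x : 'cV[R]_n) (C : set 'cV[R]_n) (c X : R) :
    C !=set0 -> 0 <= c ->
    (forall z, C z -> X <= c * dot (x - z) (x - z)) ->
  X <= c * dist x C ^+ 2.
Proof.
move=> [z0 Cz0]; rewrite le_eqVlt => /predU1P[<- /(_ _ Cz0)|c0 H].
  by rewrite !mul0r.
case: (leP X 0) => [X0|X0].
  by apply: (le_trans X0); rewrite mulr_ge0 ?sqr_ge0// ltW.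
rewrite -ler_pdivrMl// -[leLHS]sqr_sqrtr; last by rewrite mulr_ge0 ?invr_ge0 ?ltW.
rewrite ler_pXn2r ?nnegrE ?sqrtr_ge0 ?dist_ge0//.
apply: lb_le_inf; first by exists (enorm (x - z0)), z0.
move=> _ [z Cz <-]; rewrite -(@ler_pXn2r _ 2) ?nnegrE ?sqrtr_ge0 ?enorm_ge0//.
rewrite sqr_sqrtr; last by rewrite mulr_ge0 ?invr_ge0 ?ltW.
by rewrite enorm_sqr ler_pdivrMl// H.
Qed.

(** * Residuals of single constraints *)

Lemma resid_ge0 (R : realType) m n (A : 'M[R]_(m, n)) (b : 'cV[R]_m) x i : 0 <= resid A b x i.
Proof. by rewrite /resid mxE le_max lexx orbT. Qed.

Lemma residE (R : realType) m n (A : 'M[R]_(m, n)) (b : 'cV[R]_m) x i :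
  resid A b x i = Num.max (dot (arow A i) x - b i 0) 0.
Proof. by rewrite /resid !mxE -arow_dot mxE. Qed.

Lemma resid_ge (R : realType) m n (A : 'M[R]_(m, n)) (b : 'cV[R]_m) x i :
  dot (arow A i) x - b i 0 <= resid A b x i.
Proof. by rewrite residE le_max lexx. Qed.

Lemma resid_gt0E (R : realType) m n (A : 'M[R]_(m, n)) (b : 'cV[R]_m) x i :
  0 < resid A b x i -> resid A b x i = dot (arow A i) x - b i 0.
Proof. by rewrite residE lt_max ltxx orbF => h; rewrite max_l ?ltW. Qed.

(** A positive residual equals [dot (arow A i) x - b i 0], and [b i 0] dominates [dot (arow A i) z]
    for feasible [z]. *)
Lemma resid_sqr_le (R : realType) m n (A : 'M[R]_(m, n)) (b : 'cV[R]_m) x z i :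
    polyhedron A b z ->
  resid A b x i ^+ 2 <= resid A b x i * dot (arow A i) (x - z).
Proof.
move=> /(_ i); rewrite arow_dot => Pz.
have := resid_ge0 A b x i; rewrite le_eqVlt => /predU1P[<-|r0].
  by rewrite expr0n mul0r.
rewrite expr2 (ler_wpM2l (ltW r0))// dotBr {1}(resid_gt0E r0); lra.
Qed.

(* Convexity of [u |-> (u^+)^2 / 2], whose derivative is [u^+]. *)
Lemma resid_sqr_convex (R : realType) m n (A : 'M[R]_(m, n)) (b : 'cV[R]_m)
    x y i :
  2 * (resid A b x i * dot (arow A i) (y - x)) <=
  resid A b y i ^+ 2 - resid A b x i ^+ 2.
Proof.
have := resid_ge0 A b x i; rewrite le_eqVlt => /predU1P[<-|r0].
  by rewrite mul0r mulr0 expr0n subr0 sqr_ge0.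
rewrite dotBr; have ry := resid_ge A b y i; have rx := resid_gt0E r0.
move: r0 rx ry; set r := resid A b x i; set s := resid A b y i => r0 rx ry.
have : r * (dot (arow A i) y - dot (arow A i) x) <= r * (s - r).
  by rewrite (ler_wpM2l (ltW r0))//; lra.
have := sqr_ge0 (r - s); nra.
Qed.

(** With [r] the residual and [s] the inner product, [r^2 <= r s] and [2 r s <= r^2 + s^2]
    suffice. *)
Lemma resid_sqr_le_dot (R : realType) m n (A : 'M[R]_(m, n)) (b : 'cV[R]_m)
    x z i : polyhedron A b z ->
  resid A b x i ^+ 2 <= dot (arow A i) (x - z) ^+ 2.
Proof.
move=> Pz; have := resid_sqr_le x i Pz; have := resid_ge0 A b x i.
have := sqr_ge0 (resid A b x i - dot (arow A i) (x - z)); nra.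
Qed.

Lemma resid_sqr_le_dist (R : realType) m n (A : 'M[R]_(m, n)) (b : 'cV[R]_m)
    x i : enorm (arow A i) = 1 -> polyhedron A b !=set0 ->
  resid A b x i ^+ 2 <= dist x (polyhedron A b) ^+ 2.
Proof.
move=> a1 P0; rewrite -[leRHS]mul1r; apply: dist_sqr_glb => // z Pz.
by rewrite mul1r (le_trans (resid_sqr_le_dot _ _ Pz))// CauchySchwarz_unit.
Qed.

(** * Largest sampled residual and the lower bound on [fobj] *)

Definition maxresid (R : realType) m n (A : 'M[R]_(m, n)) (b : 'cV[R]_m)
    (x : 'cV[R]_n) (S : {set 'I_m}) : R :=
  \big[Num.max/0]_(i in S) resid A b x i.

Lemma maxresid_ge0 (R : realType) m n (A : 'M[R]_(m, n)) (b : 'cV[R]_m) x S :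
  0 <= maxresid A b x S.
Proof. exact: bigmax_ge_id. Qed.

Lemma resid_le_maxresid (R : realType) m n (A : 'M[R]_(m, n)) (b : 'cV[R]_m)
    x (S : {set 'I_m}) i : i \in S -> resid A b x i <= maxresid A b x S.
Proof. by move=> iS; apply: (le_bigmax_cond _ (fun i => resid A b x i)). Qed.

Lemma maxresid_attained (R : realType) m n (A : 'M[R]_(m, n)) (b : 'cV[R]_m) x S :
  maxresid A b x S = 0 \/
  exists2 i, i \in S & maxresid A b x S = resid A b x i.
Proof.
rewrite /maxresid; elim/big_ind: _ => [|u v hu hv|i iS]; first by left.
  by rewrite maxEle; case: ifP.
by right; exists i.
Qed.

Lemma maxresid_argmax (R : realType) m n (A : 'M[R]_(m, n)) (b : 'cV[R]_m)
    x (S : {set 'I_m}) i : i \in S ->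
    (forall j, j \in S -> resid A b x j <= resid A b x i) ->
  maxresid A b x S = resid A b x i.
Proof.
move=> iS h; apply/le_anti/andP; split; last exact: resid_le_maxresid.
by apply: bigmax_le => //; exact: resid_ge0.
Qed.

(** Double counting: a fixed index lies in ['C(m.-1, k)] of the subsets of size [k.+1]. *)
Lemma sum_over_subsets (R : realType) (m k : nat) (g : 'I_m -> R) :
  \sum_(S : {set 'I_m} | #|S| == k.+1) \sum_(i in S) g i =
  'C(m.-1, k)%:R * \sum_i g i.
Proof.
rewrite (exchange_big_dep xpredT)//= mulr_sumr; apply: eq_bigr => i _.
rewrite sumr_const -[LHS]mulr_natl; congr (_%:R * _).
have m0 : (0 < m)%N by case: m i g => [[]|].
pose K : {set {set 'I_m}} := [set S : {set 'I_m} | #|S| == k.+1]%SET.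
have cK : #|K| = 'C(m, k.+1).
  rewrite -[m in RHS]card_ord -cardsT -cards_draws; apply: eq_card => S.
  by rewrite !inE finset.subsetT.
(* The subsets containing [i] are counted as the complement of those avoiding [i]; Pascal's rule
   gives the difference. *)
have cD : #|K :\: [set S : {set 'I_m} | i \in S]%SET| = 'C(m.-1, k.+1).
  rewrite -[m in RHS]card_ord -(cardsC1 i) -cards_draws; apply: eq_card => S.
  by rewrite !inE finset.subsetC finset.sub1set inE.
have := cardsID [set S : {set 'I_m} | i \in S]%SET K; rewrite cK cD.
have -> : 'C(m, k.+1) = ('C(m.-1, k.+1) + 'C(m.-1, k))%N by rewrite -binS prednK.
rewrite addnC => /addnI <-.
by apply: eq_card => S; rewrite !inE.
Qed.

Lemma average_over_subsets (R : realType) (m k : nat) (g : 'I_m -> R) :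
    (1 <= k <= m)%N ->
  'C(m, k)%:R^-1 * (\sum_(S : {set 'I_m} | #|S| == k) \sum_(i in S) g i) =
  k%:R / m%:R * \sum_i g i.
Proof.
case: k => // k /andP[_ km]; rewrite sum_over_subsets mulrA; congr (_ * _).
have m0 : m%:R != 0 :> R by rewrite pnatr_eq0 -lt0n (leq_ltn_trans _ km).
have C0 : 'C(m, k.+1)%:R != 0 :> R by rewrite pnatr_eq0 -lt0n bin_gt0.
apply: (mulfI C0); rewrite mulrA divff// mul1r.
apply: (mulfI m0); rewrite -natrM mul_bin_diag natrM; field.
by rewrite m0.
Qed.

(** The squared maximum over a sample is at least the mean of the squares over it. Averaging over
    samples turns these means into [1 / m] times the squared norm of the residual vector, to which
    the Hoffman bound applies. *)
Lemma fobj_ge (R : realType) m n (A : 'M[R]_(m, n)) (b : 'cV[R]_m) beta (L : R) x :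
    (1 <= beta <= m)%N -> 0 < L ->
    dist x (polyhedron A b) ^+ 2 <= L ^+ 2 * enorm (pospart (A *m x - b)) ^+ 2 ->
  mu1 m L * dist x (polyhedron A b) ^+ 2 <= 2 * fobj A b beta x.
Proof.
move=> hb L0 hL; have [/andP[b1 bm]] := (hb, hb) => _.
have b0 : 0 < beta%:R :> R by rewrite ltr0n.
have m0 : 0 < m%:R :> R by rewrite ltr0n (leq_trans b1).
have C0 : 0 < 'C(m, beta)%:R :> R by rewrite ltr0n bin_gt0.
have H : 'C(m, beta)%:R^-1 * (\sum_(S : {set 'I_m} | #|S| == beta)
    \sum_(i in S) resid A b x i ^+ 2) <= 'C(m, beta)%:R^-1 *
    (\sum_(S : {set 'I_m} | #|S| == beta) beta%:R * maxresid A b x S ^+ 2).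
  rewrite ler_pM2l ?invr_gt0//; apply: ler_sum => S /eqP Sb.
  rewrite mulr_natl -Sb -sumr_const; apply: ler_sum => i iS.
  by rewrite ler_pXn2r ?nnegrE ?resid_ge0 ?maxresid_ge0// resid_le_maxresid.
rewrite average_over_subsets// -mulr_sumr mulrCA -mulrA ler_pM2l// in H.
rewrite /fobj mulVKf ?pnatr_eq0//; apply: le_trans H.
rewrite /mu1 mul1r invfM -mulrA (ler_pM2l (_ : 0 < m%:R^-1)) ?invr_gt0// ler_pdivrMl ?exprn_gt0//.
rewrite enorm_sqr in hL; by apply: (le_trans hL); rewrite ler_pM2l ?exprn_gt0//.
Qed.

(** * The Rayleigh quotient and [lambda_max] *)

Lemma dot_trmx (R : realType) m n (M : 'M[R]_(m, n)) u v :
  dot (M *m u) v = dot u (M^T *m v).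
Proof.
have E (k : nat) (x y : 'cV[R]_k) : dot x y = (x^T *m y) 0 0.
  by rewrite mxE; apply: eq_bigr => i _; rewrite mxE.
by rewrite !E trmx_mul mulmxA.
Qed.

Lemma dot0l (R : realType) n (u : 'cV[R]_n) : dot 0 u = 0.
Proof. by rewrite /dot big1// => i _; rewrite mxE mul0r. Qed.

Lemma dot_eq0 (R : realType) n (u : 'cV[R]_n) : dot u u = 0 -> u = 0.
Proof.
move=> u0; apply/colP => i; rewrite mxE; apply/eqP.
rewrite -sqrf_eq0; apply/eqP/le_anti; rewrite sqr_ge0 andbT.
rewrite -u0 /dot (bigD1 i)//= -expr2 lerDl.
by apply: sumr_ge0 => j _; rewrite -expr2 sqr_ge0.
Qed.

(** Serves both the objective ([M := A^T]) and the sphere constraint ([M := 1%:M]) of the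
    maximization below. *)
Lemma continuous_sum_sqr (R : realType) m n (M : 'M[R]_(n, m)) :
  continuous (fun v : 'rV[R]_n => \sum_i ((v *m M) 0 i) ^+ 2).
Proof.
have cv j : continuous (fun v : 'rV[R]_n => (v *m M) 0 j).
  have -> : (fun v : 'rV[R]_n => (v *m M) 0 j) =
      (fun v : 'rV[R]_n => \sum_k v 0 k * M k j).
    by apply/funext => v; rewrite mxE.
  apply: (@continuous_big R _ +%R 0) => [|k _]; first exact: add_continuous.
  have ck := @coord_continuous R 1 n 0 k.
  by move=> v; exact: (cvgM (ck v) (cvg_cst (M k j))).
apply: (@continuous_big R _ +%R 0) => [|i _]; first exact: add_continuous.
move=> v; have cvi := cv i v.
under eq_fun do rewrite expr2.
exact: (cvgM cvi cvi).
Qed.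

(* The maximum of the Rayleigh quotient is attained by compactness of the
   sphere, and a maximizer is an eigenvector. *)
Lemma rayleigh (R : realType) m n (A : 'M[R]_(m, n)) : (0 < n)%N ->
  exists2 l : R, (forall u, dot (A *m u) (A *m u) <= l * dot u u) &
    eigenvalue (A^T *m A) l.
Proof.
move=> n0.
pose q := fun v : 'rV[R]_n => \sum_i ((v *m A^T) 0 i) ^+ 2.
pose nr := fun v : 'rV[R]_n => \sum_i ((v *m 1%:M) 0 i) ^+ 2.
have qE u : q u^T = dot (A *m u) (A *m u).
  by apply: eq_bigr => i _; rewrite -trmx_mul mxE expr2.
have nE u : nr u^T = dot u u.
  by apply: eq_bigr => i _; rewrite mulmx1 mxE expr2.
have S0 : nr @^-1` [set 1] !=set0.
  exists (delta_mx 0 (Ordinal n0)); rewrite /= /nr mulmx1.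
  rewrite (bigD1 (Ordinal n0))//= mxE !eqxx/= expr1n big1 ?addr0// => i i0.
  by rewrite mxE (negPf i0) expr0n.
have Sc : compact (nr @^-1` [set 1]).
  apply: bounded_closed_compact; last first.
    apply: preimage_closed; last exact: closed_eq.
    by move=> v _; exact: continuous_sum_sqr.
  exists 1; split; first exact: num_real.
  move=> M M1 v /= v1; rewrite [leLHS]/Num.norm /= mx_normrE.
  apply: bigmax_le => [|[i j] _ /=]; first by rewrite (le_trans _ (ltW M1)).
  rewrite (le_trans _ (ltW M1))// ord1.
  have := ler_enorm_coord v^T j; rewrite mxE => /le_trans; apply.
  rewrite -(@ler_pXn2r _ 2) ?nnegrE ?enorm_ge0// enorm_sqr -nE trmxK v1.
  by rewrite expr1n.
have [c /set_mem c1 cmax] := compact_EVT_max S0 Sc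
  (continuous_subspaceT (@continuous_sum_sqr R m n A^T)).
pose l := q c; pose e := c^T; have ee : dot e e = 1 by rewrite -nE trmxK.
have B u : dot (A *m u) (A *m u) <= l * dot u u.
  have := dot_ge0 u; rewrite le_eqVlt => /predU1P[u0|u0].
    by rewrite (dot_eq0 (esym u0)) mulmx0 !dot0l mulr0.
  pose s := Num.sqrt (dot u u); have s0 : 0 < s by rewrite sqrtr_gt0.
  have s2 : s ^+ 2 = dot u u by rewrite sqr_sqrtr// ltW.
  have := cmax (s^-1 *: u)^T; rewrite -/(q _) -/(q _) qE -/l.
  rewrite -scalemxAr !(dotZl, dotZr) -s2 mulrA -invfM -expr2.
  rewrite ler_pdivrMl ?exprn_gt0// mulrC; apply.
  rewrite inE /= nE !(dotZl, dotZr) -s2; field; exact: lt0r_neq0.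
have lE : dot (A *m e) (A *m e) = l by rewrite -qE trmxK.
(* First-order condition at the maximizer, from perturbing [e] in an arbitrary direction [w]. *)
have N w : l * dot e w - dot (A *m e) (A *m w) = 0.
  set g := LHS; apply/eqP/negPn/negP => g0.
  pose h := l * dot w w - dot (A *m w) (A *m w).
  have h0 : 0 <= h by rewrite subr_ge0.
  have H t : 0 <= 2 * t * g + t ^+ 2 * h.
    have := B (e + t *: w).
    rewrite mulmxDr -scalemxAr !(dotDl, dotDr, dotZl, dotZr) lE ee.
    rewrite (dotC w e) (dotC (A *m w) (A *m e)) /g /h.
    set a := dot e w; set b := dot w w; set cc := dot (A *m e) _.
    set d := dot (A *m w) _ => HH; lra.
  (* This value of [t] makes the quadratic in [H] negative when [g] is nonzero; [h + 1] avoids a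
     division by zero. *)
  have := H (- g / (h + 1)).
  have h1 : 0 < h + 1 by lra.
  have -> : 2 * (- g / (h + 1)) * g + (- g / (h + 1)) ^+ 2 * h =
    - (g ^+ 2 * (h + 2)) / (h + 1) ^+ 2.
    field; exact: lt0r_neq0.
  rewrite mulNr oppr_ge0 leNgt divr_gt0 ?exprn_gt0//.
  by rewrite mulr_gt0 ?exprn_even_gt0//; lra.
exists l => //; apply/eigenvalueP; exists c; last first.
  apply/eqP => c0; move: ee; rewrite /e c0 trmx0 dot0l => /eqP.
  by rewrite eq_sym oner_eq0.
have : l *: e - A^T *m (A *m e) = 0.
  set z := LHS; apply: dot_eq0; rewrite {1}/z dotBl dotZl.
  by rewrite dot_trmx trmxK N.
move/eqP; rewrite subr_eq0 => /eqP/(congr1 trmx).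
by rewrite /e !trmx_mul !trmxK linearZ/= trmxK -mulmxA => <-.
Qed.

(** The largest Rayleigh quotient [l] is an eigenvalue, and it bounds every other one, each being
    the quotient at its eigenvector. So the set of eigenvalues is bounded and its supremum is at
    least [l]. *)
Lemma dot_mulmx_le_lambda_max (R : realType) m n (A : 'M[R]_(m, n)) u :
  dot (A *m u) (A *m u) <= lambda_max (A^T *m A) * dot u u.
Proof.
have [n0|n0] := posnP n.
  have -> : u = 0 by apply/colP => i; have := ltn_ord i; rewrite [X in (_ < X)%N]n0.
  by rewrite mulmx0 !dot0l mulr0.
have [l hl el] := rayleigh A n0.
apply: (le_trans (hl u)); rewrite ler_wpM2r ?dot_ge0//.
apply: ub_le_sup => //; exists l => a /= /eigenvalueP[v va v0].
have vv : 0 < dot v^T v^T.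
  rewrite lt_neqAle dot_ge0 andbT eq_sym; apply: contra v0 => /eqP/dot_eq0.
  by move/(congr1 trmx); rewrite trmxK trmx0 => ->.
rewrite -(ler_pM2r vv) -dotZl; apply: le_trans (hl v^T).
rewrite dot_trmx dotC.
suff -> : A^T *m (A *m v^T) = a *: v^T by [].
by apply: trmx_inj; rewrite !trmx_mul !trmxK linearZ /= trmxK -mulmxA.
Qed.

Lemma lambda_max_ge0 (R : realType) m n (A : 'M[R]_(m, n)) :
  (0 < n)%N -> 0 <= lambda_max (A^T *m A).
Proof.
move=> n0; pose e : 'cV[R]_n := delta_mx (Ordinal n0) 0.
have e1 : dot e e = 1.
  rewrite /dot (bigD1 (Ordinal n0))//= big1 ?addr0 => [|i i0].
    by rewrite !mxE !eqxx mul1r.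
  by rewrite !mxE (negPf i0) mul0r.
have := dot_mulmx_le_lambda_max A e; rewrite e1 mulr1; apply: le_trans.
exact: dot_ge0.
Qed.

Lemma unit_rows_gt0 (R : realType) m n (A : 'M[R]_(m, n)) :
  (0 < m)%N -> (forall i, enorm (arow A i) = 1) -> (0 < n)%N.
Proof.
case: n A => // A m0 /(_ (Ordinal m0)).
by rewrite /enorm big_ord0 sqrtr0 => /eqP; rewrite eq_sym oner_eq0.
Qed.

(** * The upper bound on [fobj] *)

Lemma mu2_ge0 (R : realType) m n (A : 'M[R]_(m, n)) beta :
  (0 < n)%N -> 0 <= mu2 A beta.
Proof.
by move=> n0; rewrite le_min ler01/= mulr_ge0 ?divr_ge0 ?ler0n ?lambda_max_ge0.
Qed.

(** One estimate for each term of the minimum in [mu2]. Bounding a squared maximum by the squared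
    distance gives 1; bounding it by the sum of squares over the sample gives [beta / m] times the
    sum of all squared residuals, which is at most the squared norm of [A *m (x - z)]. *)
Lemma fobj_le (R : realType) m n (A : 'M[R]_(m, n)) (b : 'cV[R]_m) beta x :
    (1 <= beta <= m)%N -> (forall i, enorm (arow A i) = 1) ->
    polyhedron A b !=set0 ->
  2 * fobj A b beta x <= mu2 A beta * dist x (polyhedron A b) ^+ 2.
Proof.
move=> hb hA P0; have /andP[b1 bm] := hb.
have n0 := unit_rows_gt0 (leq_trans b1 bm) hA.
have m0 : 0 < m%:R :> R by rewrite ltr0n (leq_trans b1).
have C0 : 0 < 'C(m, beta)%:R :> R by rewrite ltr0n bin_gt0.
have D0 := sqr_ge0 (dist x (polyhedron A b)).
rewrite /fobj mulVKf ?pnatr_eq0// /mu2 minr_pMl// le_min.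
apply/andP; split.
  rewrite mul1r ler_pdivrMl// -[m in 'C(m, _)]card_ord -card_draws.
  rewrite mulr_natl cardsE -sumr_const; apply: ler_sum => S _.
  rewrite -/(maxresid A b x S).
  have [->|[i iS ->]] := maxresid_attained A b x S; first by rewrite expr0n.
  exact: resid_sqr_le_dist.
rewrite -[leRHS]mulrA.
have H : \sum_i resid A b x i ^+ 2 <=
    lambda_max (A^T *m A) * dist x (polyhedron A b) ^+ 2.
  apply: dist_sqr_glb => // [|z Pz]; first exact: lambda_max_ge0.
  apply: le_trans (dot_mulmx_le_lambda_max A _).
  apply: ler_sum => i _; rewrite -expr2 arow_dot; exact: resid_sqr_le_dot.
apply: (@le_trans _ _ (beta%:R / m%:R * \sum_i resid A b x i ^+ 2)); last first.
  by rewrite ler_wpM2l ?divr_ge0 ?ler0n.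
rewrite -average_over_subsets// ler_pM2l ?invr_gt0//.
apply: ler_sum => S _; case: (maxresid_attained A b x S) => [h|[i iS h]].
  by rewrite -/(maxresid A b x S) h expr0n sumr_ge0// => i _; rewrite sqr_ge0.
rewrite -/(maxresid A b x S) h (bigD1 i)//= lerDl sumr_ge0// => j _.
by rewrite sqr_ge0.
Qed.

(** * One momentum step and the scalar recursion *)

(* The terms [||x - z||^2] and [||y - z||^2] come from
   [2 <x - z, x - y> = ||x - z||^2 - ||y - z||^2 + ||x - y||^2]. *)
Lemma momentum_step_point (R : realType) n (a x y z x' : 'cV[R]_n)
    (delta gamma t1 r M2 : R) :
    0 <= delta -> 0 <= gamma -> 0 <= t1 -> dot a a = 1 ->
    r ^+ 2 <= r * dot a (x - z) -> 2 * (r * dot a (y - x)) <= M2 - r ^+ 2 ->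
  x' = x - (delta * r) *: a + gamma *: (x - y) ->
  dot (x' - z) (x' - z) + t1 * dot (x' - x) (x' - x) <=
  (1 + gamma) * dot (x - z) (x - z) - gamma * dot (y - z) (y - z)
  + (gamma + (1 + t1) * gamma ^+ 2) * dot (x - y) (x - y)
  + ((1 + t1) * delta ^+ 2 - 2 * delta) * r ^+ 2
  + (1 + t1) * gamma * delta * (M2 - r ^+ 2).
Proof.
move=> d0 g0 t0 aa h1 h2 ->.
pose u := x - z; pose v := x - y.
have -> : x - (delta * r) *: a + gamma *: (x - y) - z = u - (delta * r) *: a + gamma *: v.
  by rewrite /u addrAC [x - _ - z]addrAC.
have -> : x - (delta * r) *: a + gamma *: (x - y) - x = gamma *: v - (delta * r) *: a.
  by rewrite addrAC [x - _ - x]addrAC subrr add0r addrC.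
have yz : y - z = u - v by rewrite /u /v opprB [RHS]addrC addrA subrK.
have yx : y - x = - v by rewrite opprB.
rewrite yz -/u -/v.
move: h1 h2; rewrite yx -/u dotNr.
clear yz yx; clearbody u v.
rewrite !(dotNl, dotNr, dotBl, dotBr, dotDl, dotDr, dotZl, dotZr) aa.
rewrite (dotC u a) (dotC v a) (dotC v u).
move: (dot a u) (dot a v) (dot u u) (dot u v) (dot v v) => au av uu uv vv h1 h2.
have h3 := ler_wpM2l d0 h1.
have h4 : (1 + t1) * (gamma * delta) * (2 * (r * - av)) <=
          (1 + t1) * (gamma * delta) * (M2 - r ^+ 2).
  by apply: ler_wpM2l h2; rewrite !mulr_ge0// addr_ge0.
rewrite -subr_ge0 in h3 h4; rewrite -subr_ge0.
set lhs := (X in 0 <= X).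
(* The slack is [2 * delta] times that of the first inequality plus [(1 + t1) * gamma * delta] times
   that of the second. *)
suff -> : lhs = 2 * (delta * (r * au) - delta * r ^+ 2) +
   ((1 + t1) * (gamma * delta) * (M2 - r ^+ 2) -
    (1 + t1) * (gamma * delta) * (2 * (r * - av))) by lra.
rewrite /lhs; ring.
Qed.

(* Makes [D k.+1 + p * D k + t * N k.+1] a Lyapunov sequence of ratio [r]. *)
Lemma lyapunov_weight (R : realFieldType) (a1 a2 q : R) :
    0 <= a1 -> -1 < a2 -> a1 + a2 < 1 -> 0 <= q < 1 ->
  exists p r : R, [/\ -1 < p, 0 < r < 1, a1 + p <= r, a2 <= r * p & q <= r].
Proof.
move=> a10 a2l a12 /andP[q0 q1]; case: (ltP a2 0) => a20.
  (* With [p := a2] negative, [a2 <= r * p] only needs [r <= 1]. The term [2^-1] keeps [r]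
     positive. *)
  pose r := Num.max (a1 + a2) (Num.max q 2^-1).
  have r1 : r < 1 by rewrite !gt_max a12 q1/=; lra.
  exists a2, r; rewrite !le_max !lt_max !lexx !orbT r1; split=> //.
    by rewrite (_ : (0 < 2^-1 :> R) = true) ?orbT//; lra.
  nra.
(* The midpoint of [a2] and [1 - a1], so that [a1 + p < 1] and [a2 / p < 1]. *)
pose p := (a2 + 1 - a1) / 2; have p0 : 0 < p by rewrite /p; lra.
have a2p : a2 < p by rewrite /p; lra.
pose r := Num.max (a1 + p) (Num.max (a2 / p) (Num.max q 2^-1)).
have r1 : r < 1.
  rewrite !gt_max q1 ltr_pdivrMr// mul1r a2p/=.
  by apply/andP; split; rewrite /p; lra.
exists p, r; rewrite -ler_pdivrMr// !le_max !lt_max !lexx !orbT r1; split=> //.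
  by lra.
by rewrite (_ : (0 < 2^-1 :> R) = true) ?orbT//; lra.
Qed.

(** The weight [p] may be negative, so the Lyapunov bound does not control [D] alone. A second
    induction absorbs [- p * D k.+1], whose coefficient is at most [s < 1]. The constants are chosen
    before the sequences, hence do not depend on the starting point or the probability space. *)
Lemma momentum_recursion (R : realFieldType) (a1 a2 q t : R) :
    0 <= a1 -> -1 < a2 -> a1 + a2 < 1 -> 0 <= q < 1 -> 0 <= t ->
  exists alpha rho : R, [/\ 0 <= alpha, 0 < rho < 1 &
    forall D N : nat -> R, (forall k, 0 <= D k) -> (forall k, 0 <= N k) ->
      D 1%N = D 0%N -> N 1%N = 0 ->
      (forall k, D k.+2 + t * N k.+2 <= a1 * D k.+1 + a2 * D k + q * (t * N k.+1)) ->
    forall k, D k.+1 + t * N k.+1 <= rho ^+ k * (1 + alpha) * D 0%N].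
Proof.
move=> a10 a2l a12 q01 t0.
have [p [r [p1 /andP[r0 r1] ap arp qr]]] := lyapunov_weight a10 a2l a12 q01.
pose s := Num.max (- p) 0.
have s0 : 0 <= s by rewrite le_max lexx orbT.
have sp : - p <= s by rewrite le_max lexx.
have s1 : s < 1 by rewrite gt_max ltr01 andbT; lra.
pose rho := (Num.max r s + 1) / 2.
have rr : r < rho.
  by have : r <= Num.max r s; [rewrite le_max lexx|rewrite /rho => h; lra].
have sr : s < rho.
  by have : s <= Num.max r s; [rewrite le_max lexx orbT|rewrite /rho => h; lra].
have rho1 : rho < 1.
  by have : Num.max r s < 1; [rewrite gt_max r1|rewrite /rho => h; lra].
have rho0 : 0 < rho by apply: lt_trans rr.
(* Solves [alpha * (rho - s) = 1 + p], which closes the second induction. *)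
pose alpha := (1 + p) / (rho - s).
have alpha0 : 0 <= alpha by rewrite divr_ge0//; lra.
exists alpha, rho; split=> //; first by rewrite rho0.
move=> D N D0 N0 D10 N10 rec.
have V k : D k.+1 + p * D k + t * N k.+1 <= r ^+ k * ((1 + p) * D 0%N).
  elim: k => [|k IH]; first by rewrite D10 N10; lra.
  apply: (@le_trans _ _ (r * (D k.+1 + p * D k + t * N k.+1))); last first.
    by rewrite exprS -mulrA ler_pM2l.
  have h1 := ler_wpM2r (D0 k.+1) ap; have h2 := ler_wpM2r (D0 k) arp.
  have h3 := ler_wpM2r (mulr_ge0 t0 (N0 k.+1)) qr.
  have := rec k; lra.
have E : alpha * (rho - s) = 1 + p by rewrite divfK// subr_eq0 gt_eqF.
elim=> [|k IH]; first by rewrite D10 N10 mulr0 addr0 mul1r ler_peMl//; lra.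
have h1 : D k.+1 <= rho ^+ k * (1 + alpha) * D 0%N.
  by apply: le_trans IH; rewrite lerDl mulr_ge0.
have h2 := ler_wpM2l s0 h1.
have h3 := ler_wpM2r (D0 k.+1) sp.
have h4 : r ^+ k.+1 <= rho ^+ k.
  apply: (@le_trans _ _ (rho ^+ k.+1)); first by rewrite lerXn2r ?nnegrE ?ltW.
  by rewrite exprS ler_piMl ?exprn_ge0 ?ltW.
have h5 : r ^+ k.+1 * ((1 + p) * D 0%N) <= rho ^+ k * ((1 + p) * D 0%N).
  by apply: ler_wpM2r h4; apply: mulr_ge0 => //; lra.
have h6 : 0 <= rho ^+ k * (rho - s) * D 0%N.
  by rewrite !mulr_ge0 ?exprn_ge0 ?subr_ge0// ltW.
have h7 := V k.+1; rewrite -E in h5 h7; rewrite exprS; lra.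
Qed.

Lemma sum_geom_le (R : realFieldType) (rho : R) k : 0 <= rho < 1 ->
  \sum_(1 <= l < k.+1) rho ^+ l.-1 <= (1 - rho)^-1.
Proof.
move=> /andP[r0 r1]; rewrite big_add1/= -[leRHS]mul1r ler_pdivlMr ?subr_gt0//.
suff -> : (\sum_(0 <= l < k) rho ^+ l) * (1 - rho) = 1 - rho ^+ k.
  by rewrite gerBl exprn_ge0.
elim: k => [|k IH]; first by rewrite big_geq// mul0r expr0 subrr.
by rewrite big_nat_recr//= mulrDl IH exprS; ring.
Qed.

(** * Squared distance of an average *)

Lemma dist_sqr_near (R : realType) n (x : 'cV[R]_n) (C : set 'cV[R]_n) (e : R) :
    C !=set0 -> 0 < e ->
  exists2 z, C z & dot (x - z) (x - z) <= dist x C ^+ 2 + e.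
Proof.
move=> C0 e0; apply: contrapT => H.
have : dist x C ^+ 2 + e <= 1 * dist x C ^+ 2.
  apply: dist_sqr_glb => // z Cz; rewrite mul1r leNgt.
  by apply/negP => /ltW h; apply: H; exists z.
by rewrite mul1r gerDl leNgt e0.
Qed.

(** The sum of squared deviations from the mean [s] is nonnegative. *)
Lemma dot_avg_le (R : realType) n (u : nat -> 'cV[R]_n) k : (1 <= k)%N ->
  dot (k%:R^-1 *: \sum_(1 <= l < k.+1) u l) (k%:R^-1 *: \sum_(1 <= l < k.+1) u l)
  <= k%:R^-1 * \sum_(1 <= l < k.+1) dot (u l) (u l).
Proof.
move=> k1; have k0 : 0 < k%:R :> R by rewrite ltr0n.
set s := (_ *: _); rewrite ler_pdivlMl//.
have sumE v : \sum_(1 <= l < k.+1) dot (u l) v = dot (\sum_(1 <= l < k.+1) u l) v.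
  elim/big_ind2: _ => [|x1 y1 x2 y2 -> ->|//]; first by rewrite dot0l.
  by rewrite dotDl.
have sE : \sum_(1 <= l < k.+1) u l = k%:R *: s.
  by rewrite scalerA divff ?scale1r// gt_eqF.
have : 0 <= \sum_(1 <= l < k.+1) dot (u l - s) (u l - s).
  by apply: sumr_ge0 => l _; exact: dot_ge0.
have -> : \sum_(1 <= l < k.+1) dot (u l - s) (u l - s) =
    \sum_(1 <= l < k.+1) (dot (u l) (u l) - 2 * dot (u l) s + dot s s).
  by apply: eq_bigr => l _; rewrite dotBl !dotBr (dotC s (u l)); ring.
rewrite big_split sumrB -mulr_sumr sumE sE dotZl sumr_const_nat subn1/=.
rewrite -[_ *+ k]mulr_natl; lra.
Qed.

(** By convexity the average of near-minimizers [z l] for the points [x l w] is feasible; the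
    average iterate is compared with it and [e] is arbitrary. *)
Lemma dist_sqr_avg (R : realType) m n (A : 'M[R]_(m, n)) (b : 'cV[R]_m) (T : Type)
    (x : nat -> T -> 'cV[R]_n) k w : (1 <= k)%N -> polyhedron A b !=set0 ->
  dist (avg x k w) (polyhedron A b) ^+ 2 <=
  k%:R^-1 * \sum_(1 <= l < k.+1) dist (x l w) (polyhedron A b) ^+ 2.
Proof.
move=> k1 P0; have k0 : 0 < k%:R :> R by rewrite ltr0n.
apply/ler_addgt0Pr => e e0.
have /choice[z hz] : forall l, exists z, polyhedron A b z /\
    dot (x l w - z) (x l w - z) <= dist (x l w) (polyhedron A b) ^+ 2 + e.
  by move=> l; have [z ? ?] := dist_sqr_near (x l w) P0 e0; exists z.
pose zb := k%:R^-1 *: \sum_(1 <= l < k.+1) z l.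
have Pz : polyhedron A b zb.
  move=> i; rewrite -scalemxAr mxE mulmx_sumr summxE ler_pdivrMl//.
  rewrite mulr_natl -[k in leRHS]subn0 -subSS -sumr_const_nat.
  by apply: ler_sum => l _; have [/(_ i)] := hz l.
apply: (le_trans (dist_sqr_le _ Pz)).
have -> : avg x k w - zb = k%:R^-1 *: \sum_(1 <= l < k.+1) (x l w - z l).
  by rewrite sumrB scalerBr.
apply: (le_trans (dot_avg_le _ k1)).
apply: (@le_trans _ _ (k%:R^-1 * \sum_(1 <= l < k.+1)
  (dist (x l w) (polyhedron A b) ^+ 2 + e))).
  by rewrite ler_pM2l ?invr_gt0//; apply: ler_sum => l _; have [] := hz l.
rewrite big_split/= sumr_const_nat subn1/= mulrDr -[e *+ k]mulr_natl.
by rewrite mulKf// gt_eqF.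
Qed.

(** * Finite-valued random variables and their expectations *)

(** Factoring through a finite type with measurable fibres needs no sigma-algebra on [U] and is
    stable under arbitrary functions, so [dist] and [fobj] never have to be shown measurable. *)
Definition finvalued (d : measure_display) (T : measurableType d) (U : Type)
    (F : T -> U) : Prop :=
  exists (I : finType) (Y : T -> I) (g : I -> U),
    (forall i, measurable (Y @^-1` [set i])) /\ F = g \o Y.

Lemma finvalued_fin d (T : measurableType d) (I : finType) (Y : T -> I) :
  (forall i, measurable (Y @^-1` [set i])) -> finvalued Y.
Proof. by move=> mY; exists I, Y, id. Qed.

Lemma finvalued_cst d (T : measurableType d) (U : Type) (c : U) :
  finvalued (fun _ : T => c).
Proof.
exists unit, (fun=> tt), (fun=> c); split => // -[].
by rewrite preimage_cst mem_set.
Qed.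

Lemma finvalued_comp d (T : measurableType d) (U V : Type) (h : U -> V)
    (F : T -> U) : finvalued F -> finvalued (fun w => h (F w)).
Proof. by move=> [I [Y [g [mY ->]]]]; exists I, Y, (h \o g). Qed.

Lemma finvalued_pair d (T : measurableType d) (U V : Type) (F : T -> U)
    (G : T -> V) : finvalued F -> finvalued G -> finvalued (fun w => (F w, G w)).
Proof.
move=> [I [Y [g [mY ->]]]] [J [Z [h [mZ ->]]]].
exists (I * J)%type, (fun w => (Y w, Z w)), (fun ij => (g ij.1, h ij.2)).
split=> // -[i j].
rewrite (_ : _ @^-1` _ = Y @^-1` [set i] `&` Z @^-1` [set j]).
  exact: measurableI.
by apply/seteqP; split => w /= [-> ->].
Qed.

Lemma finvalued_comp2 d (T : measurableType d) (U V W : Type) (h : U -> V -> W)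
    (F : T -> U) (G : T -> V) :
  finvalued F -> finvalued G -> finvalued (fun w => h (F w) (G w)).
Proof.
by move=> fF fG; apply: (finvalued_comp (fun p => h p.1 p.2) (finvalued_pair fF fG)).
Qed.

Lemma finvalued_sum d (T : measurableType d) (V : nmodType) (I : Type) (r : seq I)
    (F : I -> T -> V) : (forall i, finvalued (F i)) ->
  finvalued (fun w => \sum_(i <- r) F i w).
Proof.
move=> fF; elim: r => [|i r IH].
  by under eq_fun do rewrite big_nil; exact: finvalued_cst.
by under eq_fun do rewrite big_cons; exact: finvalued_comp2.
Qed.

Lemma fin_decomp (T : Type) (R : realType) (I : finType) (Y : T -> I) (g : I -> R) :
  (fun w => (g (Y w))%:E) =
  (fun w => \sum_i (g i)%:E * (\1_(Y @^-1` [set i]) w)%:E)%E.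
Proof.
apply/funext => w; rewrite (bigD1 (Y w))//= big1 ?adde0 => [|i iY].
  by rewrite indicE mem_set//= mule1.
by rewrite indicE memNset ?mule0//= => /esym/eqP; rewrite (negPf iY).
Qed.

Lemma finvalued_integrable d (T : measurableType d) (R : realType)
    (P : probability T R) (F : T -> R) :
  finvalued F -> P.-integrable setT (EFin \o F).
Proof.
move=> [I [Y [g [mY ->]]]].
rewrite /comp fin_decomp; apply: integrable_sum => // i _.
by apply: integrableZl => //; exact: integrable_indic.
Qed.

(** On finite-valued variables [fine] loses nothing, by [ExE]. *)
Definition Ex d (T : measurableType d) (R : realType) (P : probability T R)
  (F : T -> R) : R := fine 'E_P[F]%E.

Section Expectation.
Context d (T : measurableType d) (R : realType) (P : probability T R).
Implicit Types F G : T -> R.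

Lemma ExE F : finvalued F -> ('E_P[F] = (Ex P F)%:E)%E.
Proof.
move=> fF; rewrite fineK// unlock integrable_fin_num//.
exact: finvalued_integrable.
Qed.

Lemma ExD F G : finvalued F -> finvalued G ->
  Ex P (fun w => F w + G w) = Ex P F + Ex P G.
Proof.
move=> fF fG; rewrite -[RHS]/(fine (Ex P F + Ex P G)%:E) EFinD -!ExE//.
rewrite /Ex; congr fine; rewrite unlock; apply: integralD_EFin => //;
  exact: finvalued_integrable.
Qed.

Lemma ExZ (c : R) F : finvalued F -> Ex P (fun w => c * F w) = c * Ex P F.
Proof.
move=> fF; rewrite -[RHS]/(fine (c * Ex P F)%:E) EFinM -!ExE//.
rewrite /Ex; congr fine; rewrite unlock.
under eq_integral do rewrite EFinM.
apply: integralZl => //.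
exact: finvalued_integrable.
Qed.

Lemma Ex_cst (c : R) : Ex P (fun=> c) = c.
Proof. by rewrite /Ex expectation_cst. Qed.

Lemma Ex_sum (I : Type) (r : seq I) (F : I -> T -> R) :
    (forall i, finvalued (F i)) ->
  Ex P (fun w => \sum_(i <- r) F i w) = \sum_(i <- r) Ex P (F i).
Proof.
move=> fF; elim: r => [|i r IH].
  by rewrite big_nil; under eq_fun do rewrite big_nil; exact: Ex_cst.
rewrite big_cons -IH -ExD//; last exact: finvalued_sum.
by under eq_fun do rewrite big_cons.
Qed.

Lemma Ex_le F G : finvalued F -> finvalued G ->
  (forall w, F w <= G w) -> Ex P F <= Ex P G.
Proof.
move=> fF fG FG; rewrite -lee_fin -!ExE// unlock.
apply: le_integral => //; try exact: finvalued_integrable.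
by move=> w _; rewrite lee_fin.
Qed.

Lemma Ex_ge0 F : (forall w, 0 <= F w) -> 0 <= Ex P F.
Proof. by move=> F0; rewrite fine_ge0// expectation_ge0. Qed.

Lemma Ex_fin (I : finType) (Y : T -> I) (g : I -> R) :
    (forall i, measurable (Y @^-1` [set i])) ->
  Ex P (fun w => g (Y w)) = \sum_i g i * fine (P (Y @^-1` [set i])).
Proof.
move=> mY; rewrite /Ex unlock fin_decomp integral_sum//; last first.
  by move=> i; apply: integrableZl => //; exact: integrable_indic.
transitivity (fine (\sum_i (g i * fine (P (Y @^-1` [set i])))%:E)); last first.
  by rewrite sumEFin.
congr fine; apply: eq_bigr => i _.
rewrite integralZl//; last exact: integrable_indic.
by rewrite integral_indic// setIT EFinM fineK// fin_num_measure.
Qed.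

(** Finite Fubini: the joint law is a product, so [Z] can be averaged out with [Y] frozen. *)
Lemma Ex_indep (I J : finType) (Y : T -> I) (Z : T -> J) (h : I -> J -> R) :
    (forall i, measurable (Y @^-1` [set i])) ->
    (forall j, measurable (Z @^-1` [set j])) ->
    (forall i j, P (Z @^-1` [set j] `&` Y @^-1` [set i]) =
                 (P (Z @^-1` [set j]) * P (Y @^-1` [set i]))%E) ->
  Ex P (fun w => h (Y w) (Z w)) =
  Ex P (fun w => \sum_j fine (P (Z @^-1` [set j])) * h (Y w) j).
Proof.
move=> mY mZ ind.
have E i j : (fun w => (Y w, Z w)) @^-1` [set (i, j)] =
    Z @^-1` [set j] `&` Y @^-1` [set i].
  by apply/seteqP; split => w /= [-> ->].
rewrite (Ex_fin (Y := fun w => (Y w, Z w)) (fun p => h p.1 p.2)); last first.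
  by move=> [i j]; rewrite E; exact: measurableI.
rewrite (Ex_fin (fun i => \sum_j fine (P (Z @^-1` [set j])) * h i j))//.
under [RHS]eq_bigr do rewrite mulr_suml.
rewrite pair_big/=; apply: eq_bigr => -[i j] _ /=.
rewrite E ind fineM ?fin_num_measure//; ring.
Qed.

End Expectation.

(** * Iterates as functions of the history *)

Definition history (m : nat) (T : Type) (tau : nat -> T -> {set 'I_m})
    (istar : nat -> T -> 'I_m) (k : nat) (w : T) : {ffun 'I_k -> {set 'I_m} * 'I_m} :=
  [ffun i : 'I_k => (tau i.+1 w, istar i.+1 w)].

(** Step [l] is stored at index [l - 1], so [history k] records steps 1 to [k], the past of step
    [k.+1]. This brings its fibres into the form used by [mskm_indep]. *)
Lemma history_fiber (m : nat) (T : Type) (tau : nat -> T -> {set 'I_m})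
    (istar : nat -> T -> 'I_m) (k : nat) (y : {ffun 'I_k -> {set 'I_m} * 'I_m})
    (i0 : 'I_m) :
  exists S j, history tau istar k @^-1` [set y] = past tau istar k.+1 S j.
Proof.
(* The default value is arbitrary, since [past] only looks at steps 1 to [k]. *)
pose ext l := if insub l.-1 is Some i then y i else (finset.set0, i0).
exists (fun l => (ext l).1), (fun l => (ext l).2).
apply/seteqP; split => w /=.
  move=> E [|l]//; rewrite ltnS => /andP[_ lk].
  by rewrite /ext -E /= insubT ffunE.
move=> H; apply/ffunP => i; rewrite ffunE.
have := H i.+1; rewrite !ltnS (ltn_ord i) => /(_ isT).
by rewrite /ext /= valK => -[-> ->]; case: (y i).
Qed.

Lemma history_measurable d (T : measurableType d) (m k : nat)
    (tau : nat -> T -> {set 'I_m}) (istar : nat -> T -> 'I_m) y :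
    (forall k S, (1 <= k)%N -> measurable (tau k @^-1` [set S])) ->
    (forall k i, (1 <= k)%N -> measurable (istar k @^-1` [set i])) ->
  measurable (history tau istar k @^-1` [set y]).
Proof.
move=> mt mi.
rewrite (_ : _ @^-1` _ = \bigcap_(i in [set: 'I_k])
  (tau i.+1 @^-1` [set (y i).1] `&` istar i.+1 @^-1` [set (y i).2])).
  by apply: fin_bigcap_measurable => // i _; apply: measurableI; auto.
apply/seteqP; split => w /= => [<- i _|H]; first by rewrite /= ffunE.
by apply/ffunP => i; rewrite ffunE; have [/= -> ->] := H i I; case: (y i).
Qed.

(** Choose a preimage under [Y]; [u0] is the value off the range of [Y]. *)
Lemma factor_through (T I U : Type) (u0 : U) (Y : T -> I) (F : T -> U) :
  (forall w w', Y w = Y w' -> F w = F w') -> exists g, F = g \o Y.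
Proof.
move=> H.
exists (fun i => if pselect (exists w, Y w = i) is left e then F (projT1 (cid e))
                 else u0).
apply/funext => w /=; case: pselect => [e|[]]; last by exists w.
by case: cid => w' /= /H.
Qed.

Section MSKM.
Context (R : realType) (m n : nat) (A : 'M[R]_(m, n)) (b : 'cV[R]_m) (beta : nat)
  (delta gamma : R) (x0 : 'cV[R]_n) (d : measure_display) (T : measurableType d)
  (P : probability T R) (tau : nat -> T -> {set 'I_m}) (istar : nat -> T -> 'I_m)
  (x : nat -> T -> 'cV[R]_n).
Hypothesis hx : is_MSKM A b beta delta gamma x0 P tau istar x.
Hypothesis hbeta : (1 <= beta <= m)%N.

(** The momentum term makes the recursion second order, so the induction carries two consecutive
    iterates. *)
Lemma mskm_determined k w w' :
    (forall l, (1 <= l < k)%N -> istar l w = istar l w') ->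
  x k w = x k w' /\ x k.-1 w = x k.-1 w'.
Proof.
elim: k => [|[|k] IH] H; first by rewrite !(mskm_x0 hx).
  by rewrite !(mskm_x0 hx) !(mskm_x1 hx).
have [|e1 e2] := IH; first by move=> l /andP[l1 lk]; apply: H; rewrite l1 ltnW.
by rewrite (mskm_step hx w (ltn0Sn k)) (mskm_step hx w' (ltn0Sn k)) /= e1 e2 H//= ltnSn.
Qed.

Lemma mskm_history j k : (j <= k.+1)%N ->
  exists g, x j = g \o history tau istar k.
Proof.
move=> jk; apply: (factor_through 0) => w w' H.
apply: (proj1 (mskm_determined (k := j) _)) => -[|l]//= lj.
have lk : (l < k)%N by rewrite -ltnS (leq_trans lj).
by move/ffunP/(_ (Ordinal lk)): H; rewrite !ffunE /= => -[].
Qed.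

Lemma mskm_finvalued k : finvalued (x k).
Proof.
have [g ->] := mskm_history (leqnSn k).
exists {ffun 'I_k -> {set 'I_m} * 'I_m}, (history tau istar k), g; split => // y.
by apply: history_measurable => // *;
  [exact: (mskm_tau_meas hx)|exact: (mskm_istar_meas hx)].
Qed.

Lemma mskm_tau_finvalued k : finvalued (tau k.+1).
Proof. by apply: finvalued_fin => S; exact: (mskm_tau_meas hx). Qed.

(** For [j <= k.+1] the iterate [x j] is a function of the first [k] steps, of which [tau k.+1] is
    independent; averaging over the sample alone gives [2 * fobj]. *)
Lemma Ex_maxresid j k : (j <= k.+1)%N ->
  Ex P (fun w => maxresid A b (x j w) (tau k.+1 w) ^+ 2) =
  2 * Ex P (fun w => fobj A b beta (x j w)).
Proof.
move=> jk; have [g ->] := mskm_history jk.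
have m0 : (0 < m)%N by case/andP: hbeta => /leq_trans; apply.
rewrite (Ex_indep (P := P) (Y := history tau istar k) (Z := tau k.+1)
    (fun y S => maxresid A b (g y) S ^+ 2)); last 3 first.
- by move=> y; apply: history_measurable => // *;
    [exact: (mskm_tau_meas hx)|exact: (mskm_istar_meas hx)].
- by move=> S; exact: (mskm_tau_meas hx).
- move=> y S; have [Sp [jp ->]] := history_fiber tau istar y (Ordinal m0).
  exact: (mskm_indep hx).
rewrite -ExZ; last first.
  apply: (@finvalued_comp _ _ _ _ (fun y => fobj A b beta (g y))).
  apply: finvalued_fin => y.
  by apply: history_measurable => // *;
    [exact: (mskm_tau_meas hx)|exact: (mskm_istar_meas hx)].
congr (Ex P _); apply/funext => w /=.
rewrite /fobj mulVKf ?pnatr_eq0// mulr_sumr [RHS]big_mkcond/=.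
apply: eq_bigr => S _; case: eqP => [Sb|Sb].
  by rewrite (mskm_tau_unif hx).
(* Subsets of the wrong size are never sampled, and [fobj] omits them. *)
rewrite (_ : tau k.+1 @^-1` _ = set0) ?measure0 ?mul0r//.
by rewrite -subset0 => w' /= E; apply: Sb; rewrite -E (mskm_tau_card hx).
Qed.

End MSKM.

(** * Almost sure convergence from summable steps *)

HB.instance Definition _ (R : realType) (m n : nat) := Complete.on 'M[R]_(m, n).

(** The telescoping series converges absolutely, the sup norm being at most the Euclidean one, and
    the space is complete. *)
Lemma cvg_bounded_length (R : realType) n (x : nat -> 'cV[R]_n) (M : R) :
  (forall k, \sum_(0 <= i < k) enorm (x i.+1 - x i) <= M) -> cvgn x.
Proof.
move=> H; have E : x = (fun k => x 0%N + series (telescope x) k).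
  by apply/funext => k; exact: eq_sum_telescope.
rewrite E; apply: is_cvgD; first exact: is_cvg_cst.
apply: normed_cvg.
apply: (@series_le_cvg R _ (fun k => enorm (x k.+1 - x k))) => [k|k|k|] /=.
- exact: normr_ge0.
- exact: enorm_ge0.
- rewrite [leLHS]/Num.norm /= mx_normrE.
  apply: bigmax_le => [|[i j] _ /=]; first exact: enorm_ge0.
  by rewrite ord1 ler_enorm_coord.
apply: nondecreasing_is_cvgn.
  by apply: nondecreasing_series => k _ _; exact: enorm_ge0.
by exists M => _ [k _ <-]; exact: H.
Qed.

(** Exchanging sum and integral bounds the integral of the series by a geometric sum, so the series
    is finite almost everywhere. *)
Lemma ae_bounded_sum d (T : measurableType d) (R : realType)
    (P : probability T R) (y : nat -> T -> R) (K theta : R) :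
    (forall k, finvalued (y k)) -> (forall k w, 0 <= y k w) ->
    0 < theta < 1 -> (forall k, Ex P (y k) <= K * theta ^+ k) ->
  {ae P, forall w, exists M, forall k, \sum_(0 <= i < k) y i w <= M}.
Proof.
move=> fy y0 /andP[t0 t1] hy.
have my k : measurable_fun [set: T] (fun w => (y k w)%:E).
  by have /integrableP[] := finvalued_integrable P (fy k).
have S : (\int[P]_w \sum_(k <oo) (y k w)%:E <= (K / (1 - theta))%:E)%E.
  rewrite integral_nneseries//; last by move=> k w _; rewrite lee_fin.
  apply: lime_le.
    apply: is_cvg_nneseries => k _ _; apply: integral_ge0 => w _.
    by rewrite lee_fin.
  apply: nearW => k.
  rewrite (eq_bigr (fun i => (Ex P (y i))%:E)); last first.
    by move=> i _; rewrite -ExE// unlock.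
  rewrite sumEFin lee_fin.
  apply: (@le_trans _ _ (series (geometric K theta) k)); first exact: ler_sum.
  apply: geometric_le_lim => //; last by rewrite gtr0_norm.
  (* The bound at [k = 0] forces [0 <= K]. *)
  by have := hy 0%N; rewrite mulr1; apply: le_trans; exact: Ex_ge0.
have I : P.-integrable setT (fun w => \sum_(k <oo) (y k w)%:E)%E.
  apply/integrableP; split.
    apply: (@ge0_emeasurable_sum _ _ _ _ _ xpredT) => // k w _ _.
    by rewrite lee_fin.
  under eq_integral do (rewrite gee0_abs;
    last by apply: nneseries_ge0 => k _ _; rewrite lee_fin).
  exact: le_lt_trans S (ltry _).
have := integrable_ae measurableT I.
apply: filterS => w /(_ Logic.I) fw.
exists (fine (\sum_(k <oo) (y k w)%:E)%E) => k.
rewrite -lee_fin fineK// -sumEFin.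
by apply: nneseries_lim_ge => i _; rewrite lee_fin.
Qed.

(** * Descent of the squared distance, pointwise and in expectation *)

Section Descent.
Context (R : realType) (m n : nat) (A : 'M[R]_(m, n)) (b : 'cV[R]_m) (beta : nat)
  (delta gamma t1 L : R) (x0 : 'cV[R]_n) (d : measure_display)
  (T : measurableType d) (P : probability T R) (tau : nat -> T -> {set 'I_m})
  (istar : nat -> T -> 'I_m) (x : nat -> T -> 'cV[R]_n).
Hypothesis hx : is_MSKM A b beta delta gamma x0 P tau istar x.
Hypothesis hbeta : (1 <= beta <= m)%N.
Hypothesis hA : forall i, enorm (arow A i) = 1.
Hypothesis hP : polyhedron A b !=set0.
Hypothesis hL0 : 0 < L.
Hypothesis hL : forall x : 'cV[R]_n,
  dist x (polyhedron A b) ^+ 2 <= L ^+ 2 * enorm (pospart (A *m x - b)) ^+ 2.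
Hypothesis d0 : 0 <= delta.
Hypothesis g0 : 0 <= gamma.
Hypothesis t0 : 0 <= t1.

Let dist2 k w := dist (x k w) (polyhedron A b) ^+ 2.
Let step2 k w := dot (x k w - x k.-1 w) (x k w - x k.-1 w).
(** [c4] and [c5] collect the coefficients of the squared largest residuals at the current and the
    previous iterate in the one-step bound. *)
Let c4 := (1 + t1) * delta ^+ 2 - 2 * delta - (1 + t1) * gamma * delta.
Let c5 := (1 + t1) * gamma * delta.

(** The selected row attains the maximum over the sample at [x k.+1], and its residual at [x k] is
    at most the maximum over the same sample; this removes the selected index from the bound. *)
Lemma mskm_step_point k w :
  dist2 k.+2 w + t1 * step2 k.+2 w <=
  (1 + gamma) * dist2 k.+1 w + - gamma * dist2 k w
  + (gamma + (1 + t1) * gamma ^+ 2) * step2 k.+1 w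
  + c4 * maxresid A b (x k.+1 w) (tau k.+1 w) ^+ 2
  + c5 * maxresid A b (x k w) (tau k.+1 w) ^+ 2.
Proof.
have [ist imax] := mskm_argmax hx w (ltn0Sn k).
rewrite (maxresid_argmax ist imax).
set r := resid A b (x k.+1 w) (istar k.+1 w); set M := maxresid A b (x k w) _.
set S := step2 k.+1 w.
(* Only the term in [(1 + gamma)] needs an infimum over [z]. The other distances stand on the
   smaller side with nonnegative coefficients, where [dist_sqr_le] suffices. *)
suff : dist2 k.+2 w + t1 * step2 k.+2 w + gamma * dist2 k w
    - (gamma + (1 + t1) * gamma ^+ 2) * S - c4 * r ^+ 2 - c5 * M ^+ 2
    <= (1 + gamma) * dist2 k.+1 w by lra.
apply: dist_sqr_glb => // [|z Pz]; first by have := g0; lra.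
have aa : dot (arow A (istar k.+1 w)) (arow A (istar k.+1 w)) = 1.
  by rewrite -enorm_sqr hA expr1n.
have h1 := resid_sqr_le (x k.+1 w) (istar k.+1 w) Pz.
have h2 : 2 * (r * dot (arow A (istar k.+1 w)) (x k w - x k.+1 w)) <= M ^+ 2 - r ^+ 2.
  apply: (le_trans (resid_sqr_convex _ _ _ _ _)); rewrite lerD2r.
  by rewrite ler_pXn2r ?nnegrE ?resid_ge0 ?maxresid_ge0// resid_le_maxresid.
have := momentum_step_point d0 g0 t0 aa h1 h2 (mskm_step hx w (ltn0Sn k)).
have h3 := dist_sqr_le (x k.+2 w) Pz.
have h4 := ler_wpM2l g0 (dist_sqr_le (x k w) Pz).
rewrite /= -/(step2 k.+2 w) -/(step2 k.+1 w) -/S /dist2 /c4 /c5 -/r.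
lra.
Qed.

Lemma finvalued_dist2 k : finvalued (dist2 k).
Proof.
exact: (finvalued_comp (fun y => dist y (polyhedron A b) ^+ 2) (mskm_finvalued hx k)).
Qed.

Lemma finvalued_step2 k : finvalued (step2 k).
Proof.
exact: (finvalued_comp2 (fun y z => dot (y - z) (y - z)) (mskm_finvalued hx k)
  (mskm_finvalued hx k.-1)).
Qed.

Lemma finvalued_fobj k : finvalued (fun w => fobj A b beta (x k w)).
Proof. exact: (finvalued_comp _ (mskm_finvalued hx k)). Qed.

Lemma finvalued_maxresid j k :
  finvalued (fun w => maxresid A b (x j w) (tau k.+1 w) ^+ 2).
Proof.
exact: (finvalued_comp2 (fun y S => maxresid A b y S ^+ 2) (mskm_finvalued hx j)
  (mskm_tau_finvalued hx k)).
Qed.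

Lemma finvaluedZ (c : R) (F : T -> R) : finvalued F -> finvalued (fun w => c * F w).
Proof. exact: finvalued_comp. Qed.

Lemma finvaluedD (F G : T -> R) :
  finvalued F -> finvalued G -> finvalued (fun w => F w + G w).
Proof. exact: finvalued_comp2. Qed.

(** As [c4 <= 0], the term at the current iterate takes the lower bound on [fobj] with [mu1]; as
    [c5 >= 0], the one at the previous iterate takes the upper bound with [mu2]. *)
Lemma mskm_Ex_recursion k : c4 <= 0 ->
  Ex P (dist2 k.+2) + t1 * Ex P (step2 k.+2) <=
  (1 + gamma + c4 * mu1 m L) * Ex P (dist2 k.+1)
  + (- gamma + c5 * mu2 A beta) * Ex P (dist2 k)
  + (gamma + (1 + t1) * gamma ^+ 2) * Ex P (step2 k.+1).
Proof.
move=> c40.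
have fd := finvalued_dist2; have fs := finvalued_step2.
have fm := finvalued_maxresid.
have fZ c F (fF : finvalued F) := finvaluedZ c fF.
have H : Ex P (fun w => dist2 k.+2 w + t1 * step2 k.+2 w) <=
    Ex P (fun w => (1 + gamma) * dist2 k.+1 w + - gamma * dist2 k w
  + (gamma + (1 + t1) * gamma ^+ 2) * step2 k.+1 w
  + c4 * maxresid A b (x k.+1 w) (tau k.+1 w) ^+ 2
  + c5 * maxresid A b (x k w) (tau k.+1 w) ^+ 2).
  by apply: Ex_le => [||w]; [..|exact: mskm_step_point];
    repeat apply: finvaluedD; auto.
move: H; rewrite !ExD; auto; try by repeat apply: finvaluedD; auto.
rewrite !ExZ// !(Ex_maxresid hx hbeta)//.
have h1 : mu1 m L * Ex P (dist2 k.+1) <= 2 * Ex P (fun w => fobj A b beta (x k.+1 w)).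
  rewrite -!ExZ//; last exact: finvalued_fobj.
  by apply: Ex_le => [||w]; [exact: fZ|exact/fZ/finvalued_fobj|exact: fobj_ge].
have h2 : 2 * Ex P (fun w => fobj A b beta (x k w)) <= mu2 A beta * Ex P (dist2 k).
  rewrite -!ExZ//; last exact: finvalued_fobj.
  by apply: Ex_le => [||w]; [exact/fZ/finvalued_fobj|exact: fZ|exact: fobj_le].
have c50 : 0 <= c5 by rewrite !mulr_ge0// addr_ge0.
have := ler_wpM2l c50 h2; have := ler_wnM2l c40 h1; lra.
Qed.

(* [||D|| <= theta ^ k + ||D||^2 / theta ^ k] with [theta = sqrt rho] turns the
   geometric decay of [E ||D||^2] into summability of [E ||D||]. *)
Lemma mskm_cvg (K rho : R) : 0 < rho < 1 ->
    (forall k, Ex P (step2 k.+1) <= K * rho ^+ k) ->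
  {ae P, forall w, cvgn (fun k => x k w)}.
Proof.
move=> /andP[r0 r1] H.
pose theta := Num.sqrt rho.
have th0 : 0 < theta by rewrite sqrtr_gt0.
have th1 : theta < 1 by rewrite -sqrtr1 ltr_sqrt.
have thE k : rho ^+ k = theta ^+ k * theta ^+ k.
  by rewrite -exprMn -expr2 sqr_sqrtr// ltW.
pose y k w := enorm (x k.+1 w - x k w).
have fy k : finvalued (y k).
  exact: (finvalued_comp2 (fun u v => enorm (u - v)) (mskm_finvalued hx k.+1)
    (mskm_finvalued hx k)).
suff Ey k : Ex P (y k) <= (1 + K) * theta ^+ k.
  have th01 : 0 < theta < 1 by rewrite th0.
  have := ae_bounded_sum fy (fun k w => enorm_ge0 _) th01 Ey.
  by apply: filterS => w [M hM]; exact: (cvg_bounded_length hM).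
have tk : 0 < theta ^+ k by rewrite exprn_gt0.
have fs := finvalued_step2 k.+1.
apply: (@le_trans _ _ (Ex P (fun w =>
    theta ^+ k + (theta ^+ k)^-1 * step2 k.+1 w))).
  apply: Ex_le => [||w]; first exact: fy.
    exact: (finvaluedD (finvalued_cst _ _) (finvaluedZ _ fs)).
  rewrite /step2 -enorm_sqr -/(y k w).
  have : 0 <= (theta ^+ k)^-1 * ((y k w - theta ^+ k) ^+ 2 + y k w * theta ^+ k).
    rewrite mulr_ge0 ?invr_ge0 ?addr_ge0 ?sqr_ge0// ?mulr_ge0 ?enorm_ge0//;
    exact: ltW.
  have -> : (theta ^+ k)^-1 * ((y k w - theta ^+ k) ^+ 2 + y k w * theta ^+ k) =
      theta ^+ k + (theta ^+ k)^-1 * y k w ^+ 2 - y k w.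
    by field; rewrite expf_neq0// lt0r_neq0.
  by rewrite subr_ge0.
rewrite ExD; [|exact: finvalued_cst|exact: finvaluedZ].
rewrite Ex_cst ExZ// mulrDl mul1r lerD2l ler_pdivrMl//.
by rewrite mulrCA -thE.
Qed.

End Descent.

(** * From the parameter conditions to the rate, and from the rate to the averages *)

Theorem theorem4p6 (R : realType) (m n : nat) (A : 'M[R]_(m, n)) (b : 'cV[R]_m)
    (beta : nat) (L delta gamma t1 : R)
    (hA : forall i, enorm (arow A i) = 1)
    (hP : polyhedron A b !=set0)
    (hbeta : (1 <= beta <= m)%N)
    (hL0 : 0 < L)
    (hL : forall x : 'cV[R]_n,
      dist x (polyhedron A b) ^+ 2 <= L ^+ 2 * enorm (pospart (A *m x - b)) ^+ 2)
    (hdelta : 0 < delta < 2)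
    (hgamma : 0 <= gamma < 1)
    (ht1 : 0 <= t1)
    (hgt : gamma < (-1 + Num.sqrt (4 * t1 + 4 * t1 ^+ 2 + 1)) / (2 * (1 + t1)))
    (hlow : gamma * mu2 A beta / mu1 m L < 2 / (1 + t1) - delta + gamma)
    (hupp : 2 / (1 + t1) - delta + gamma
      <= (1 + gamma) / (delta * mu1 m L * (1 + t1))) :
  exists alpha rho : R, [/\ 0 <= alpha, 0 < rho < 1 &
    forall (d : measure_display) (T : measurableType d) (P : probability T R)
      (tau : nat -> T -> {set 'I_m}) (istar : nat -> T -> 'I_m)
      (x0 : 'cV[R]_n) (x : nat -> T -> 'cV[R]_n),
    is_MSKM A b beta delta gamma x0 P tau istar x ->
    [/\ {ae P, forall w, cvgn (fun k => x k w)},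
        (forall k : nat,
          ('E_P[fun w => (dist (x k.+1 w) (polyhedron A b) ^+ 2)%R]
            <= (rho ^+ k * (1 + alpha) * dist x0 (polyhedron A b) ^+ 2)%R%:E)%E
          /\
          ('E_P[fun w => fobj A b beta (x k.+1 w)]
            <= (mu2 A beta * (1 + alpha) / 2 * rho ^+ k
                * dist x0 (polyhedron A b) ^+ 2)%R%:E)%E) &
        (forall k : nat, (1 <= k)%N ->
          ('E_P[fun w => (dist (avg x k w) (polyhedron A b) ^+ 2)%R]
            <= ((1 + alpha) * dist x0 (polyhedron A b) ^+ 2
                / (k%:R * (1 - rho)))%R%:E)%E
          /\
          ('E_P[fun w => fobj A b beta (avg x k w)]
            <= (mu2 A beta * (1 + alpha) / (2 * k%:R * (1 - rho))
                * dist x0 (polyhedron A b) ^+ 2)%R%:E)%E)]].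
Proof.
have /andP[d0 d2] := hdelta; have /andP[g0 g1] := hgamma.
have /andP[b1 bm] := hbeta.
have m0 : 0 < m%:R :> R by rewrite ltr0n (leq_trans b1).
have n0 := unit_rows_gt0 (leq_trans b1 bm) hA.
have mu2_0 : 0 <= mu2 A beta by exact: mu2_ge0.
have mu1_0 : 0 < mu1 m L by rewrite /mu1 mul1r invr_gt0 mulr_gt0 ?exprn_gt0.
pose c := 2 / (1 + t1) - delta + gamma.
have t11 : 0 < 1 + t1 by lra.
have hlow' : gamma * mu2 A beta < c * mu1 m L by rewrite -ltr_pdivrMr.
have c0 : 0 < c.
  by rewrite -(pmulr_lgt0 _ mu1_0); apply: le_lt_trans hlow'; rewrite mulr_ge0.
have hupp' : c * (delta * mu1 m L * (1 + t1)) <= 1 + gamma.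
  have h : 0 < delta * mu1 m L * (1 + t1) by rewrite mulr_gt0// mulr_gt0.
  by rewrite -(ler_pdivlMr _ _ h).
pose c4 := (1 + t1) * delta ^+ 2 - 2 * delta - (1 + t1) * gamma * delta.
pose c5 := (1 + t1) * gamma * delta.
(* Positivity of the middle quantity [c] in the hypotheses gives the sign of [c4]. *)
have c4E : c4 = - (delta * (1 + t1) * c).
  by rewrite /c4 /c; field; exact: lt0r_neq0.
have c40 : c4 <= 0 by rewrite c4E oppr_le0 !mulr_ge0// ltW.
pose a1 := 1 + gamma + c4 * mu1 m L.
pose a2 := - gamma + c5 * mu2 A beta.
(* This is the upper condition [hupp] rewritten. *)
have a10 : 0 <= a1 by rewrite /a1 c4E; lra.
have c50 : 0 <= c5 by rewrite !mulr_ge0// ltW.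
have a2l : -1 < a2.
  have h := mulr_ge0 c50 mu2_0; rewrite /a2; lra.
(* Here [1 - (a1 + a2)] is [delta * (1 + t1)] times the gap in [hlow']. *)
have a12 : a1 + a2 < 1.
  have dt : 0 < delta * (1 + t1) by rewrite mulr_gt0.
  have h : delta * (1 + t1) * (gamma * mu2 A beta) < delta * (1 + t1) * (c * mu1 m L).
    by rewrite ltr_pM2l.
  rewrite /a1 /a2 c4E /c5; lra.
pose q1 := gamma + (1 + t1) * gamma ^+ 2.
(* Squaring the bound on [gamma] leaves a difference that factors as [4 * (1 + t1) * (t1 - q1)]. *)
have q1t : q1 < t1.
  have h : 2 * (1 + t1) * gamma + 1 < Num.sqrt (4 * t1 + 4 * t1 ^+ 2 + 1).
    by move: hgt; rewrite ltr_pdivlMr; [|lra]; lra.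
  have h0 : 0 <= 2 * (1 + t1) * gamma + 1.
    by rewrite addr_ge0 ?mulr_ge0 ?(ltW t11).
  have : (2 * (1 + t1) * gamma + 1) ^+ 2 < 4 * t1 + 4 * t1 ^+ 2 + 1.
    rewrite -[ltRHS]sqr_sqrtr; first by rewrite ltr_pXn2r// nnegrE sqrtr_ge0.
    by have := sqr_ge0 t1; lra.
  rewrite -subr_gt0 (_ : _ - _ = 4 * (1 + t1) * (t1 - q1)); last by rewrite /q1; ring.
  by rewrite pmulr_rgt0 ?subr_gt0//; lra.
have q10 : 0 <= q1 by rewrite addr_ge0// mulr_ge0 ?sqr_ge0// ltW.
(* Positivity of [t1] follows from [0 <= q1 < t1], so the steps enter the recursion with weight [t1]
   and ratio [q1 / t1]. *)
have t10 : 0 < t1 by lra.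
have q01 : 0 <= q1 / t1 < 1 by rewrite divr_ge0//= ltr_pdivrMr// mul1r.
have [alpha [rho [alpha0 rho01 hrec]]] := momentum_recursion a10 a2l a12 q01 ht1.
have /andP[rho0 rho1] := rho01.
exists alpha, rho; split=> // d T P tau istar x0 x hx.
set C := polyhedron A b.
pose D k := Ex P (fun w => dist (x k w) C ^+ 2).
pose N k := Ex P (fun w => dot (x k w - x k.-1 w) (x k w - x k.-1 w)).
have x0E : x 0%N = fun=> x0 by apply/funext => w; exact: (mskm_x0 hx).
have x1E : x 1%N = fun=> x0 by apply/funext => w; exact: (mskm_x1 hx).
have D0E : D 0%N = dist x0 C ^+ 2 by rewrite /D x0E Ex_cst.
have DN k : D k.+1 + t1 * N k.+1 <= rho ^+ k * (1 + alpha) * D 0%N.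
  apply: hrec => [j|j|||j].
  - by apply: Ex_ge0 => w; exact: sqr_ge0.
  - by apply: Ex_ge0 => w; exact: dot_ge0.
  - by rewrite D0E /D x1E Ex_cst.
  - by rewrite /N x1E /= x0E /= subrr dot0l Ex_cst.
  - rewrite mulrA divfK ?gt_eqF//.
    exact: (mskm_Ex_recursion hx hbeta hA hP hL0 hL (ltW d0) g0 ht1 j c40).
have N0 k : 0 <= N k by apply: Ex_ge0 => w; exact: dot_ge0.
have D0 k : 0 <= D k by apply: Ex_ge0 => w; exact: sqr_ge0.
have DB k : D k.+1 <= rho ^+ k * (1 + alpha) * dist x0 C ^+ 2.
  by rewrite -D0E; apply: le_trans (DN k); rewrite lerDl mulr_ge0.
have fx := mskm_finvalued hx.
(* Every distance bound yields the matching bound on [fobj] through the factor [mu2 / 2]. *)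
have fobjB (y : T -> 'cV[R]_n) (B : R) : finvalued y ->
    Ex P (fun w => dist (y w) C ^+ 2) <= B ->
    ('E_P[fun w => fobj A b beta (y w)] <= (mu2 A beta / 2 * B)%:E)%E.
  move=> fy hB; rewrite ExE; last exact: (finvalued_comp _ fy).
  rewrite lee_fin.
  apply: (@le_trans _ _ (Ex P (fun w => mu2 A beta / 2 * dist (y w) C ^+ 2))).
    apply: Ex_le => [||w]; [exact: (finvalued_comp _ fy)| |].
      exact: (finvalued_comp (fun z => mu2 A beta / 2 * dist z C ^+ 2) fy).
    by have := @fobj_le _ _ _ A b beta (y w) hbeta hA hP; rewrite -/C; lra.
  rewrite ExZ; last exact: (finvalued_comp (fun z => dist z C ^+ 2) fy).
  by rewrite ler_wpM2l// divr_ge0.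
have fd (y : T -> 'cV[R]_n) : finvalued y -> finvalued (fun w => dist (y w) C ^+ 2).
  exact: (finvalued_comp (fun z => dist z C ^+ 2)).
split.
(* Dropping the distance from [DN] and dividing by [t1] bounds the expected squared steps. *)
- apply: (mskm_cvg hx (K := (1 + alpha) * D 0%N / t1) rho01) => k.
  rewrite mulrAC ler_pdivlMr// mulrC [leRHS]mulrC.
  rewrite mulrA; apply: le_trans (DN k); by rewrite lerDr.
- move=> k; split; first by rewrite ExE ?lee_fin; [exact: DB|exact: fd].
  have := fobjB _ _ (fx k.+1) (DB k).
  by congr (_ <= _%:E)%E; ring.
- move=> k k1; have k0 : 0 < k%:R :> R by rewrite ltr0n.
  have favg : finvalued (avg x k).
    apply: (@finvalued_comp _ _ _ _ (fun s => k%:R^-1 *: s)).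
    exact: finvalued_sum.
  have Davg : Ex P (fun w => dist (avg x k w) C ^+ 2) <=
      (1 + alpha) * dist x0 C ^+ 2 / (k%:R * (1 - rho)).
    apply: (@le_trans _ _ (Ex P (fun w =>
        k%:R^-1 * \sum_(1 <= l < k.+1) dist (x l w) C ^+ 2))).
      apply: Ex_le => [||w]; [exact: fd| |exact: dist_sqr_avg].
      apply: (@finvalued_comp _ _ _ _ (fun s => k%:R^-1 * s)).
      by apply: finvalued_sum => l; exact: fd.
    rewrite ExZ; last by apply: finvalued_sum => l; exact: fd.
    rewrite Ex_sum; last by move=> l; exact: fd.
    rewrite invfM mulrCA ler_pM2l ?invr_gt0//.
    apply: (@le_trans _ _ (\sum_(1 <= l < k.+1)
        rho ^+ l.-1 * ((1 + alpha) * dist x0 C ^+ 2))).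
      (* The sum starts at [l = 1], so [DB] applies at [l - 1]. *)
      rewrite big_nat [leRHS]big_nat; apply: ler_sum => -[|l] //= _.
      by rewrite mulrA; exact: DB.
    rewrite -mulr_suml mulrC ler_wpM2l//.
      by rewrite mulr_ge0 ?sqr_ge0// addr_ge0.
    by apply: sum_geom_le; rewrite ltW.
  split; first by rewrite ExE ?lee_fin//; exact: fd.
  have := fobjB _ _ favg Davg.
  congr (_ <= _%:E)%E; field.
  by rewrite subr_eq0 !gt_eqF.
Qed.
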